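(* Let $k$ be a positive integer. For two virtual knots $K$ and $K'$, the following are equivalent: (i) $J(K)\equiv J(K')\pmod{2k}$, where $J$ denotes the odd writhe. (ii) $K$ and $K'$ are related by a finite sequence of $2k$-moves and $\Xi$-moves.
   Context: **Gauss diagrams and virtual knots.** A Gauss diagram is an oriented circle with finitely many chords, each having a sign $\pm1$ and an orientation (from its initial to its terminal endpoint), whose endpoints are distinct points of the circle; it is considered up to orientation-preserving homeomorphism of the circle, i.e. only the cyclic order of endpoints matters. Endpoints are called consecutive (adjacent) if no other endpoints lie between them on the circle. A virtual knot is an equivalence class of Gauss diagrams under the Reidemeister moves (a Gauss diagram in the class is called a Gauss diagram of the knot): - Move I: add or remove a chord (any sign and orientation) whose two endpoints are adjacent. - Move II: add or remove two chords of opposite signs whose initial endpoints are adjacent and whose terminal endpoints are adjacent. - Move III: suppose there are three pairwise disjoint arcs $T,M,B$ of the circle and three chords $c_{TM}$, $c_{TB}$, $c_{MB}$, oriented from $T$ to $M$, from $T$ to $B$, from $M$ to $B$ respectively, with signs $e_{TM},e_{TB},e_{MB}$, such that each arc contains exactly two endpoints, both belonging to these chords. Put $\delta_T=+1$ if $c_{TM}$ comes before $c_{TB}$ along $T$ (else $-1$), $\delta_M=+1$ if $c_{TM}$ comes before $c_{MB}$ along $M$ (else $-1$), $\delta_B=+1$ if $c_{TB}$ comes before $c_{MB}$ along $B$ (else $-1$). If for some $c\in\{\pm1\}$ one has $\delta_T=c\,e_{TB}$, $\delta_M=c\,e_{MB}$, $\delta_B=c\,e_{TM}e_{TB}e_{MB}$,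 then the move exchanges the two endpoints on each of the three arcs. (Equivalently, virtual knots are virtual knot diagrams modulo generalized Reidemeister moves; chords correspond to real crossings, oriented from over to under.) **$2k$-move.** A $2k$-move on a Gauss diagram adds or removes $2k$ chords $\gamma_1,\dots,\gamma_{2k}$, all of the same sign $\varepsilon$, for which there are two disjoint arcs $A,A'$ of the circle such that each $\gamma_i$ joins $A$ to $A'$, the arcs contain no other endpoints, the endpoints on $A$ occur in the order $\gamma_1,\dots,\gamma_{2k}$, the endpoints on $A'$ occur in the order $\gamma_1,\dots,\gamma_{2k}$ or in the reverse order, and initial and terminal endpoints alternate along $A$ (hence also along $A'$). (This corresponds to adding or removing $2k$ half-twists on two strands of a diagram.) **$\Xi$-move.** Let $P_1,P_2,P_3$ be three consecutive endpoints of chords of a Gauss diagram. A $\Xi$-move exchanges the positions of $P_1$ and $P_3$, preserving the signs and orientations of the chords (so if $P_1,P_3$ are the two endpoints of one chord, the move interchanges its initial and terminal endpoints on the circle). Two virtual knots are related by a $2k$-move (resp. $\Xi$-move) if some Gauss diagram of one is obtained from some Gauss diagram of the other by that move. **Odd writhe.** Let $\gamma$ be a chord with sign $\varepsilon$ in a Gauss diagram $G$. Assign $\varepsilon$ to its terminal endpoint and $-\varepsilon$ to its initial endpoint. Let $\alpha$ be the open arc of the circle running, along the orientation of the circle, from the initial endpoint of $\gamma$ to its terminal endpoint. The index $\mathrm{ind}(\gamma)$ is the sum of the signs of all endpoints of chords on $\alpha$. For an integer $n$, $J_n(G)$ is the sum of signs of the chords of $G$ with index $n$. For $n\neq 0$,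 $J_n(G)$ is an invariant of the virtual knot $K$ represented by $G$ (known result), denoted $J_n(K)$. The odd writhe is $J(K)=\sum_{n\in\mathbb{Z}}J_{2n-1}(K)$. *)

(* Defs.v *)
From HB Require Import structures.
From Stdlib Require Import Relation_Operators.
From mathcomp Require Import all_boot all_order all_algebra.
From mathcomp Require Import boolp classical_sets fsbigop.

Set Implicit Arguments.
Unset Strict Implicit.
Unset Printing Implicit Defensive.

Import Order.TTheory GRing.Theory Num.Theory.
Local Open Scope ring_scope.

(* A Gauss diagram is presented by the sequence of its chord endpoints, read
   along the oriented circle from an arbitrary base point.  An endpoint is a
   triple (name of its chord, is it initial?, is the chord positive?); the
   choice of base point and of names is divided out by [gauss_iso]. *)
Definition endpoint : Type := nat * bool * bool.

Definition chord_name (p : endpoint) : nat := p.1.1.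
Definition is_initial (p : endpoint) : bool := p.1.2.
Definition is_positive (p : endpoint) : bool := p.2.

Definition sign (b : bool) : int := if b then 1 else - 1.

Definition other_end (p : endpoint) : endpoint :=
  (chord_name p, ~~ is_initial p, is_positive p).

Definition is_gauss_word (w : seq endpoint) : bool :=
  uniq [seq (chord_name p, is_initial p) | p <- w]
  && all (fun p => other_end p \in w) w.

Record gauss_diagram := GaussDiagram {
  gauss_word :> seq endpoint;
  _ : is_gauss_word gauss_word
}.

HB.instance Definition _ := [isSub for gauss_word].
HB.instance Definition _ := [Choice of gauss_diagram by <:].

Definition rename (f : nat -> nat) (p : endpoint) : endpoint :=
  (f (chord_name p), is_initial p, is_positive p).

Inductive gauss_iso : seq endpoint -> seq endpoint -> Prop :=
| GaussIso (n : nat) (f : nat -> nat) (w : seq endpoint) :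
    {in [seq chord_name p | p <- w] &, injective f} ->
    gauss_iso w [seq rename f p | p <- rot n w].

(* The moves below are written for one position of the base point (just
   before the first arc involved); the other positions are obtained by
   composing with [gauss_iso]. *)

Definition move1 (w w' : seq endpoint) : Prop :=
  exists (x : nat) (i e : bool), w = [:: (x, i, e); (x, ~~ i, e)] ++ w'.

(* The flag r records the order of the two terminal endpoints. *)
Definition move2 (w w' : seq endpoint) : Prop :=
  exists (x y : nat) (e r : bool) (u v : seq endpoint),
    let tx := (x, false, e) in
    let ty := (y, false, ~~ e) in
    w = [:: (x, true, e); (y, true, ~~ e)] ++ u
        ++ (if r then [:: ty; tx] else [:: tx; ty]) ++ v
    /\ w' = u ++ v.

Definition arc2 (d : bool) (p q : endpoint) : seq endpoint :=
  if d then [:: p; q] else [:: q; p].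

(* x, y, z are the chords TM, TB, MB; dT, dM, dB encode the signs delta. *)
Definition triangle (x y z : nat) (eTM eTB eMB dT dM dB : bool)
    (TMB : bool) (u v t : seq endpoint) : seq endpoint :=
  let T := arc2 dT (x, true, eTM) (y, true, eTB) in
  let M := arc2 dM (x, false, eTM) (z, true, eMB) in
  let B := arc2 dB (y, false, eTB) (z, false, eMB) in
  if TMB then T ++ u ++ M ++ v ++ B ++ t else T ++ u ++ B ++ v ++ M ++ t.

Definition move3 (w w' : seq endpoint) : Prop :=
  exists (x y z : nat) (eTM eTB eMB dT dM dB c TMB : bool)
         (u v t : seq endpoint),
    [/\ sign dT = sign c * sign eTB,
        sign dM = sign c * sign eMB &
        sign dB = sign c * (sign eTM * sign eTB * sign eMB)] /\
    w = triangle x y z eTM eTB eMB dT dM dB TMB u v t /\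
    w' = triangle x y z eTM eTB eMB (~~ dT) (~~ dM) (~~ dB) TMB u v t.

Definition reidemeister_step (G G' : gauss_diagram) : Prop :=
  [\/ gauss_iso G G', move1 G G', move2 G G' | move3 G G'].

Definition reidemeister_equiv (G G' : gauss_diagram) : bool :=
  `[< clos_refl_sym_trans gauss_diagram reidemeister_step G G' >].

Lemma reidemeister_equiv_refl : reflexive reidemeister_equiv.
Proof. by move=> G; apply/asboolP; apply: rst_refl. Qed.

Lemma reidemeister_equiv_sym : symmetric reidemeister_equiv.
Proof. by move=> G G'; apply/asboolP/asboolP => h; apply: rst_sym. Qed.

Lemma reidemeister_equiv_trans : transitive reidemeister_equiv.
Proof.
move=> G2 G1 G3 /asboolP h12 /asboolP h23.
by apply/asboolP; apply: (rst_trans _ _ _ G2).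
Qed.

Canonical reidemeister_equiv_rel :=
  EquivRel reidemeister_equiv reidemeister_equiv_refl
    reidemeister_equiv_sym reidemeister_equiv_trans.

Definition virtual_knot : Type := {eq_quot reidemeister_equiv}%qT.

Definition knot_of (G : gauss_diagram) : virtual_knot :=
  \pi_({eq_quot reidemeister_equiv})%qT G.

Definition diagram_of (K : virtual_knot) : gauss_diagram :=
  repr (K : {eq_quot reidemeister_equiv}%qT).

(* Adds 2k chords, named g_0, ..., g_(2k-1).  The flag i tells whether the
   endpoint of g_0 on the first arc is initial, and r whether the order is
   reversed on the second arc. *)
Definition twist_move (k : nat) (w w' : seq endpoint) : Prop :=
  exists (g : nat -> nat) (e i r : bool) (u v : seq endpoint),
    let A := [seq (g j, i (+) odd j, e) | j <- iota 0 (2 * k)] in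
    let A' := [seq other_end p | p <- A] in
    w = u ++ v /\ w' = A ++ u ++ (if r then rev A' else A') ++ v.

Definition xi_move (w w' : seq endpoint) : Prop :=
  exists (p1 p2 p3 : endpoint) (u : seq endpoint),
    w = [:: p1; p2; p3] ++ u /\ w' = [:: p3; p2; p1] ++ u.

Definition related_by (move : seq endpoint -> seq endpoint -> Prop)
    (K K' : virtual_knot) : Prop :=
  exists G G' : gauss_diagram,
    [/\ knot_of G = K, knot_of G' = K' & move G G' \/ move G' G].

Definition endpoint_sign (p : endpoint) : int :=
  if is_initial p then - sign (is_positive p) else sign (is_positive p).

(* A chord is given by its initial endpoint p; [arc w p q] is the cyclic arc
   of w from p (included) to q (excluded). *)
Definition ind (w : seq endpoint) (p : endpoint) : int :=
  \sum_(q <- behead (arc w p (other_end p))) endpoint_sign q.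

Definition diagram_writhe (w : seq endpoint) (n : int) : int :=
  \sum_(p <- w | is_initial p && (ind w p == n)) sign (is_positive p).

(* For n != 0 this does not depend on the chosen representative. *)
Definition knot_writhe (K : virtual_knot) (n : int) : int :=
  diagram_writhe (diagram_of K) n.

(* A sum with finite support, since a diagram has finitely many chords. *)
Definition odd_writhe (K : virtual_knot) : int :=
  \sum_(n \in [set: int]) knot_writhe K (2 * n - 1).

(* Main.v *)
(* The odd writhe only depends on positions: a chord has odd index iff its two
   endpoints sit at positions of the same parity, so J is the sum of the signs
   of these chords.  Each move either fixes all such parities, flips both ends
   of a chord together, or inserts chords whose contribution is explicit (0 or
   +-2k for a 2k-move); hence J mod 2k is invariant.

   Conversely, Xi-moves permute arbitrarily the endpoints at even positions
   among themselves, and likewise those at odd positions.  A chord joining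
   positions of different parities can thus be made isolated and removed by a
   move I; an even-position chord and an odd-position chord of opposite signs
   can be laid out as x y x y and removed by a move II.  What is left is a
   diagram determined up to Xi-moves by the common sign of its chords and by
   their number 2m, that is, by its odd writhe +-2m.  Finally a 2k-move with
   adjacent arcs changes J by 2k or -2k, so congruent odd writhes can be made
   equal. *)
Require Import Defs.
From Stdlib Require Import Relation_Operators.
From mathcomp Require Import all_boot all_order all_algebra.
From mathcomp Require Import boolp classical_sets fsbigop.

Set Implicit Arguments.
Unset Strict Implicit.
Unset Printing Implicit Defensive.

Import Order.TTheory GRing.Theory Num.Theory.

(** * Closure properties of Gauss words *)

Section GaussWords.

Implicit Types (w u v s t : seq endpoint) (p q : endpoint).

Lemma other_endK : involutive other_end.
Proof. by move=> [[n i] e]; rewrite /other_end /= negbK. Qed.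

Lemma other_end_neq p : (other_end p == p) = false.
Proof. by case: p => [[n []] e]; rewrite /other_end !xpair_eqE /= andbF. Qed.

Lemma gauss_uniq w : is_gauss_word w -> uniq w.
Proof. by case/andP=> /map_uniq. Qed.

Lemma gauss_other w p : is_gauss_word w -> p \in w -> other_end p \in w.
Proof. by case/andP=> _ /allP; apply. Qed.

Lemma gauss_otherE w p : is_gauss_word w -> (other_end p \in w) = (p \in w).
Proof.
move=> gw; apply/idP/idP; last exact: gauss_other.
by move/(gauss_other gw); rewrite other_endK.
Qed.

Lemma gauss_perm w w' : perm_eq w w' -> is_gauss_word w = is_gauss_word w'.
Proof.
move=> pw; rewrite /is_gauss_word (perm_uniq (perm_map _ pw)); congr andb.
by rewrite (perm_all _ pw); apply: eq_all => p; rewrite (perm_mem pw).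
Qed.

(** A partner in [u] of an endpoint of [v] would put that endpoint itself in [u], against
    uniqueness; so no chord joins [u] to [v]. *)
Lemma gauss_catr u v :
  all (fun p => other_end p \in u) u -> is_gauss_word (u ++ v) ->
  is_gauss_word v.
Proof.
move=> /allP cu guv; have := guv.
rewrite {1}/is_gauss_word map_cat cat_uniq => /andP[/and3P[_ _ uv] _].
rewrite /is_gauss_word uv; apply/allP=> p pv.
have : other_end p \in u ++ v by rewrite gauss_otherE // mem_cat pv orbT.
rewrite mem_cat => /orP[/cu|//]; rewrite other_endK => pu.
have := gauss_uniq guv; rewrite cat_uniq => /and3P[_ /hasPn/(_ _ pv)].
by rewrite pu.
Qed.

Lemma gauss_cat u v :
  is_gauss_word u -> is_gauss_word v ->
  {in u & v, forall p q, chord_name p != chord_name q} ->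
  is_gauss_word (u ++ v).
Proof.
move=> /andP[uu cu] /andP[uv cv] duv; rewrite /is_gauss_word map_cat cat_uniq.
rewrite uu uv all_cat !andbT; apply/and3P; split.
- apply/hasPn=> _ /mapP[q qv ->]; apply/mapP=> -[p pu [epq _]].
  by have := duv p q pu qv; rewrite epq eqxx.
- by apply: sub_all cu => p; rewrite mem_cat => ->.
- by apply: sub_all cv => p; rewrite mem_cat => ->; rewrite orbT.
Qed.

Lemma perm_initial w (I := [seq p <- w | is_initial p]) :
  is_gauss_word w -> perm_eq w (I ++ map other_end I).
Proof.
move=> gw; have uw := gauss_uniq gw.
apply: uniq_perm => //.
  rewrite cat_uniq filter_uniq // (map_inj_uniq (inv_inj other_endK)).
  rewrite filter_uniq // andbT; apply/hasPn=> _ /mapP[p + ->].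
  rewrite !mem_filter => /andP[ip _].
  by rewrite negb_and {1}/is_initial /= -/(is_initial p) ip.
move=> p; rewrite mem_cat -[X in X \in map _ _]other_endK.
rewrite (mem_map (inv_inj other_endK)) !mem_filter gauss_otherE //.
rewrite [in RHS]/is_initial /= -/(is_initial p).
by case: is_initial; case: (p \in w).
Qed.

Lemma gauss_even w : is_gauss_word w -> ~~ odd (size w).
Proof.
by move/perm_initial/perm_size ->; rewrite size_cat size_map addnn odd_double.
Qed.

End GaussWords.

(** * The odd writhe as a count of position parities, and its change under the moves *)

Section ParityWrithe.

Local Open Scope ring_scope.

Implicit Types (w u v s t : seq endpoint) (p q : endpoint).

(** Ends at positions of different parity enclose an even number of endpoints, each of sign plus or
    minus one; this is the condition that the index is even. *)
Definition even_chord w p : bool :=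
  odd (index p w) (+) odd (index (other_end p) w).

Definition parity_writhe w : int :=
  \sum_(p <- w | is_initial p && ~~ even_chord w p) sign (is_positive p).

Lemma even_chord_other w p : even_chord w (other_end p) = even_chord w p.
Proof. by rewrite /even_chord other_endK addbC. Qed.

Lemma eq_even_chord w w' :
  is_gauss_word w ->
  {in w, forall p, odd (index p w') = odd (index p w)} ->
  {in w, forall p, even_chord w' p = even_chord w p}.
Proof. by move=> gw h p pw; rewrite /even_chord !h ?gauss_otherE. Qed.

Lemma eq_parity_writhe w w' :
  perm_eq w w' -> {in w, forall p, even_chord w' p = even_chord w p} ->
  parity_writhe w' = parity_writhe w.
Proof.
move=> pw h; rewrite /parity_writhe -(perm_big _ pw) /=.
rewrite big_seq_cond [RHS]big_seq_cond; apply: eq_bigl => p.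
by case pw0: (p \in w) => //=; rewrite h.
Qed.

(** A rotation shifts all positions by the same amount modulo the length of the word, and that
    length is even. *)
Lemma odd_index_rot n w p :
  ~~ odd (size w) -> uniq w -> p \in w -> (n <= size w)%N ->
  odd (index p (rot n w)) = odd n (+) odd (index p w).
Proof.
move=> ew uw pw len; have sn : size (take n w) = n by rewrite size_takel.
have sd : odd (size (drop n w)) = odd n.
  by move: ew; rewrite -{1}(cat_take_drop n w) size_cat sn oddD; do 2!case: odd.
move: uw pw; rewrite /rot -{1 2 5}(cat_take_drop n w) cat_uniq mem_cat.
case/and3P=> _ /hasPn dj _; rewrite !index_cat.
case: (boolP (p \in drop n w)) => [pd _|pd].
  by rewrite (negbTE (dj _ pd)) oddD sn addbA addbb.
by rewrite orbF => ->; rewrite oddD sd.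
Qed.

Lemma parity_writhe_rot n w :
  is_gauss_word w -> parity_writhe (rot n w) = parity_writhe w.
Proof.
move=> gw; have [len|/ltnW lt] := leqP n (size w); last by rewrite rot_oversize.
apply: eq_parity_writhe; first by rewrite perm_sym perm_rot.
move=> p pw; rewrite /even_chord.
rewrite !odd_index_rot ?gauss_otherE ?gauss_even ?gauss_uniq //.
by do 3!case: odd.
Qed.

Lemma parity_writhe_rename (f : nat -> nat) w :
  is_gauss_word w -> {in [seq chord_name p | p <- w] &, injective f} ->
  parity_writhe [seq rename f p | p <- w] = parity_writhe w.
Proof.
move=> gw fi; rewrite /parity_writhe big_map.
have ri : {in w &, injective (rename f)}.
  move=> [[n i] e] [[m j] e'] pw qw [enm].
  rewrite /is_initial /is_positive /= => -> ->; congr (_, _, _).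
  by apply: fi enm; [exact: (map_f chord_name pw)|exact: (map_f chord_name qw)].
have ei p : p \in w -> index (rename f p) (map (rename f) w) = index p w.
  move=> pw; have := pw; rewrite -index_mem => ipw.
  rewrite -{1}(nth_index p pw) -(nth_map p (rename f p)) //.
  by rewrite index_uniq ?size_map // map_inj_in_uniq // gauss_uniq.
rewrite big_seq_cond [RHS]big_seq_cond; apply: eq_bigl => p.
case pw: (p \in w) => //=; rewrite /even_chord ei //.
have -> : other_end (rename f p) = rename f (other_end p) by [].
by rewrite ei // gauss_otherE.
Qed.

(** The inserted blocks have even length, so the other endpoints keep their parities; together they
    are closed under [other_end], so the sum splits into old and new chords. *)
Lemma parity_writhe_insert u1 u2 v1 v2 (w := u1 ++ v1 ++ u2 ++ v2) :
  is_gauss_word w -> ~~ odd (size u1) -> ~~ odd (size u2) ->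
  all (fun p => other_end p \in u1 ++ u2) (u1 ++ u2) ->
  parity_writhe w = parity_writhe (v1 ++ v2)
    + \sum_(p <- u1 ++ u2 | is_initial p && ~~ even_chord w p)
        sign (is_positive p).
Proof.
move=> gw e1 e2 cu.
have pw : perm_eq w ((u1 ++ u2) ++ (v1 ++ v2)).
  by rewrite /w -catA perm_cat2l perm_catCA.
have gv : is_gauss_word (v1 ++ v2).
  by apply: gauss_catr cu _; rewrite -(gauss_perm pw).
have := gauss_uniq gw; rewrite (perm_uniq pw) cat_uniq => /and3P[_ /hasPn dj _].
have h : {in v1 ++ v2, forall p, odd (index p w) = odd (index p (v1 ++ v2))}.
  move=> p pv; have := dj _ pv; rewrite mem_cat negb_or => /andP[n1 n2].
  move: pv; rewrite mem_cat /w !index_cat (negbTE n1) (negbTE n2).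
  rewrite oddD (negbTE e1) /=; case: ifP => //= _ _.
  by rewrite !oddD (negbTE e2).
rewrite {1}/parity_writhe (perm_big _ pw) /= big_cat /= addrC; congr (_ + _).
rewrite big_seq_cond [RHS]big_seq_cond; apply: eq_bigl => p.
by case pv: (p \in _) => //=; rewrite (eq_even_chord gv h).
Qed.

Lemma parity_writhe_move1 w w' :
  is_gauss_word w -> move1 w w' -> parity_writhe w = parity_writhe w'.
Proof.
move=> gw [x [i [e ew]]]; rewrite ew in gw *.
have := @parity_writhe_insert [:: (x, i, e); (x, ~~ i, e)] [::] [::] w' gw isT isT.
rewrite /= !inE /other_end /= negbK !eqxx !orbT => -> //.
(* Adjacent ends have opposite parities, so the added chord is even and adds nothing. *)
rewrite !big_cons big_nil /even_chord /= /other_end /= negbK.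
by rewrite !xpair_eqE !eqxx; case: (i); case: (e); rewrite /= addr0.
Qed.

Lemma parity_writhe_move2 w w' :
  is_gauss_word w -> move2 w w' -> parity_writhe w = parity_writhe w'.
Proof.
move=> gw [x [y [e [r [u [v [ew ->]]]]]]]; rewrite ew in gw *.
have := gauss_uniq gw.
set a : endpoint := (x, true, e); set b : endpoint := (y, true, ~~ e).
set c : endpoint := (x, false, e); set d : endpoint := (y, false, ~~ e).
set A : seq endpoint := [:: a; b]; set B : seq endpoint := if r then _ else _.
move=> uw; have -> := @parity_writhe_insert A B u v gw isT.
- rewrite -[RHS]addr0; congr (_ + _).
  (* The initial ends are neighbours and so are the terminal ends: passing from one chord to the
     other flips both parities. The opposite signs then cancel. *)
  have es : even_chord (A ++ u ++ B ++ v) a = even_chord (A ++ u ++ B ++ v) b.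
    have ca : other_end a = c by []. have cb : other_end b = d by [].
    move: uw; rewrite catA cat_uniq => /and3P[uA /hasPn dj uB].
    have iB p : p \in B ->
        index p ((A ++ u) ++ (B ++ v)) = (size (A ++ u) + index p B)%N.
      by move=> pB; rewrite index_cat (negbTE (dj p _)) ?index_cat ?mem_cat pB.
    have ab : (a == b) = false.
      by move: uA; rewrite /= !inE negb_or => /andP[/andP[/negbTE]].
    have cd : (c == d) = false.
      by move: uB; rewrite /B; case: (r);
        rewrite /= !inE negb_or => /andP[/andP[/negbTE]] //; rewrite eq_sym.
    have [cB dB] : c \in B /\ d \in B by rewrite /B; case: (r);
      rewrite !inE !eqxx orbT.
    rewrite /even_chord ca cb (iB _ cB) (iB _ dB) !oddD.
    have -> : index a ((A ++ u) ++ B ++ v) = 0%N by rewrite /= eqxx.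
    have -> : index b ((A ++ u) ++ B ++ v) = 1%N by rewrite /= ab eqxx.
    by rewrite /B; case: (r); rewrite /= !eqxx ?cd 1?eq_sym ?cd; case: odd.
  move: (even_chord _) es => tau; rewrite /A /B /a /b /c /d.
  by case: (r) => /= es; rewrite !big_cons big_nil /= es;
    case: (tau _); case: (e); rewrite //= addr0.
- by rewrite /B; case: (r).
- by rewrite /B /A /other_end /=; case: (r); rewrite /= !inE /= !eqxx !orbT.
Qed.

Lemma odd_index_swap u p q v r :
  uniq (u ++ [:: p; q] ++ v) ->
  odd (index r (u ++ [:: q; p] ++ v))
  = odd (index r (u ++ [:: p; q] ++ v)) (+) (p == r) (+) (q == r).
Proof.
rewrite cat_uniq => /and3P[_ /hasPn dj /andP[]].
rewrite inE negb_or => /andP[/negbTE npq _] _; rewrite !index_cat.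
case: ifP => [ru|_].
  have nr z : z \in [:: p; q] -> (z == r) = false.
    move=> zpq; apply: contraTF ru => /eqP <-; apply: dj.
    by rewrite mem_cat zpq.
  by rewrite !nr ?inE ?eqxx ?orbT ?addbF.
rewrite !inE ![r == _]eq_sym /= !oddD.
case: (eqVneq p r) npq => [<-|_ _]; first by rewrite eq_sym => ->; case: odd.
by case: (q == r); case: odd => /=; rewrite ?addbF.
Qed.

Lemma odd_index_arc2 d u p q v r :
  uniq (u ++ arc2 d p q ++ v) ->
  odd (index r (u ++ arc2 (~~ d) p q ++ v))
  = odd (index r (u ++ arc2 d p q ++ v)) (+) (p == r) (+) (q == r).
Proof.
by case: d => /odd_index_swap -> //; rewrite -!addbA; congr addb; rewrite addbC.
Qed.

Lemma perm_arc2 d p q : perm_eq (arc2 (~~ d) p q) (arc2 d p q).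
Proof. by case: d; apply/permP => a; rewrite /= !addn0 addnC. Qed.

(** The exchanges flip the parity of exactly the six listed endpoints. These form whole chords, so
    both ends of a chord flip together. Both cyclic orders of the arcs in move III are instances. *)
Lemma parity_writhe_arcs d1 d2 d3 p1 q1 p2 q2 p3 q3 u v t
    (S := [:: p1; q1; p2; q2; p3; q3])
    (w := fun d1 d2 d3 => arc2 d1 p1 q1 ++ u ++ arc2 d2 p2 q2 ++ v
                          ++ arc2 d3 p3 q3 ++ t) :
  is_gauss_word (w d1 d2 d3) -> perm_eq (map other_end S) S ->
  parity_writhe (w (~~ d1) (~~ d2) (~~ d3)) = parity_writhe (w d1 d2 d3).
Proof.
move=> gw pS.
have p1w : perm_eq (w (~~ d1) d2 d3) (w d1 d2 d3).
  by rewrite perm_cat2r perm_arc2.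
have p2w : perm_eq (w (~~ d1) (~~ d2) d3) (w (~~ d1) d2 d3).
  by rewrite !perm_cat2l perm_cat2r perm_arc2.
have p3w : perm_eq (w (~~ d1) (~~ d2) (~~ d3)) (w (~~ d1) (~~ d2) d3).
  by rewrite !perm_cat2l perm_cat2r perm_arc2.
have u0 := gauss_uniq gw.
have u1 : uniq (w (~~ d1) d2 d3) by rewrite (perm_uniq p1w).
have u2 : uniq (w (~~ d1) (~~ d2) d3) by rewrite (perm_uniq p2w).
have swS r : odd (index r (w (~~ d1) (~~ d2) (~~ d3)))
    = odd (index r (w d1 d2 d3)) (+) \big[addb/false]_(q <- S) (q == r).
  have s1 := @odd_index_arc2 d1 [::] p1 q1 _ r u0.
  have := @odd_index_arc2 d2 (arc2 (~~ d1) p1 q1 ++ u) p2 q2 (v ++ arc2 d3 p3 q3 ++ t) r.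
  rewrite -!catA => /(_ u1) s2.
  have := @odd_index_arc2 d3 (arc2 (~~ d1) p1 q1 ++ u ++ arc2 (~~ d2) p2 q2 ++ v)
           p3 q3 t r.
  rewrite -!catA => /(_ u2) s3.
  by rewrite /w s3 s2 s1 !big_cons big_nil addbF !addbA.
apply: eq_parity_writhe.
  by rewrite perm_sym (perm_trans p3w) // (perm_trans p2w).
move=> r _; rewrite /even_chord !swS.
have -> : \big[addb/false]_(q <- S) (q == other_end r)
        = \big[addb/false]_(q <- S) (q == r).
  rewrite -[RHS](perm_big _ pS) big_map /=; apply: eq_bigr => q _.
  by rewrite (inv_eq other_endK).
by case: (\big[addb/false]_(q <- S) _); do 2!case: odd.
Qed.

Lemma parity_writhe_move3 w w' :
  is_gauss_word w -> move3 w w' -> parity_writhe w = parity_writhe w'.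
Proof.
move=> gw [x [y [z [e1 [e2 [e3 [d1 [d2 [d3 [c [b [u [v [t [_ [ew ->]]]]]]]]]]]]]]]].
rewrite ew in gw *; apply/esym; rewrite /triangle; case: b gw {ew} => gw.
all: apply: parity_writhe_arcs gw _; apply/permP => a /=; rewrite /other_end /=.
all: by do 6!case: (a _).
Qed.

(** The exchanged endpoints are two places apart, so every endpoint keeps its parity. *)
Lemma parity_writhe_xi w w' :
  is_gauss_word w -> xi_move w w' -> parity_writhe w = parity_writhe w'.
Proof.
move=> gw [p1 [p2 [p3 [u [ew ->]]]]]; rewrite ew in gw *; apply/esym.
apply: eq_parity_writhe.
  by apply/permP=> a /=; do 3!case: (a _).
have /= := gauss_uniq gw; rewrite !inE !negb_or.
case/and3P=> /andP[/negbTE n12 /andP[/negbTE n13 _]] /andP[/negbTE n23 _] _.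
move=> r _; suff h z : odd (index z ([:: p3; p2; p1] ++ u))
    = odd (index z ([:: p1; p2; p3] ++ u)) by rewrite /even_chord !h.
rewrite /=; case: (eqVneq p1 z) => [<-|_].
  by rewrite [p3 == _]eq_sym n13 [p2 == _]eq_sym n12.
by case: (eqVneq p2 z) => [<-|_]; rewrite ?[p3 == _]eq_sym ?n23 //; case: ifP.
Qed.

Lemma index_rev (T : eqType) (s : seq T) x :
  uniq s -> x \in s -> index x (rev s) = (size s - (index x s).+1)%N.
Proof.
move=> us xs; have lt : (index x s < size s)%N by rewrite index_mem.
have lt' : (size s - (index x s).+1 < size s)%N.
  by rewrite ltn_subrL (leq_ltn_trans _ lt).
have e : x = nth x (rev s) (size s - (index x s).+1).
  by rewrite nth_rev // subnSK // subKn 1?ltnW // nth_index.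
by rewrite {1}e index_uniq ?rev_uniq // size_rev.
Qed.

(** The ends of the [j]-th chord lie at positions [j] and [2 * k + size u + j], or
    [2 * k + size u + (2 * k - j.+1)] in the reversed case. The difference of parities is the same
    for all [j], so the new chords are all even or all counted. *)
Lemma parity_writhe_twist k (g : nat -> nat) (e i r : bool) u v
    (A := [seq (g j, i (+) odd j, e) | j <- iota 0 (2 * k)])
    (A' := [seq other_end p | p <- A])
    (w := A ++ u ++ (if r then rev A' else A') ++ v) :
  is_gauss_word w ->
  parity_writhe w = parity_writhe (u ++ v)
    + (if odd (size u) (+) r then 0 else sign e *+ (2 * k)).
Proof.
set B := if r then _ else _ in w * => gw.
have pB : perm_eq B A' by rewrite /B; case: (r); rewrite // perm_rev.
have sA : size A = (2 * k)%N by rewrite size_map size_iota.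
have pAB : perm_eq (A ++ B) (A ++ A') by rewrite perm_cat2l.
have uw := gauss_uniq gw.
have [uA uA'] : uniq A /\ uniq A'.
  rewrite (map_inj_uniq (inv_inj other_endK)).
  by have := uw; rewrite cat_uniq => /andP[].
have tauA p : p \in A -> even_chord w p = odd (size u) (+) r.
  move=> pA; have oA' : other_end p \in A' by apply: map_f.
  have oB : other_end p \in B by rewrite (perm_mem pB).
  have [oA ou] : other_end p \notin A /\ other_end p \notin u.
    have := uw; rewrite /w (catA A u) cat_uniq => /and3P[_ /hasPn dj _].
    have : other_end p \notin A ++ u by apply: dj; rewrite mem_cat oB.
    by rewrite mem_cat negb_or => /andP.
  rewrite /even_chord /w !index_cat pA (negbTE oA) (negbTE ou) oB sA mul2n !oddD.
  rewrite odd_double /= addbCA; congr addb.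
  have iA' : index (other_end p) A' = index p A.
    by rewrite index_map //; apply: (inv_inj other_endK).
  rewrite /B; case: (r); last by rewrite iA' addbb.
  rewrite index_rev // iA' size_map sA oddB; last by rewrite -sA index_mem.
  by rewrite oddM /= addbN addbb.
have tauB p : p \in A' -> even_chord w p = odd (size u) (+) r.
  by case/mapP=> q qA ->; rewrite even_chord_other tauA.
rewrite {1}/w parity_writhe_insert ?sA ?oddM //; first last.
- apply/allP=> p; rewrite !(perm_mem pAB) !mem_cat => /orP[pA|/mapP[q qA ->]].
    by rewrite (map_f other_end pA) orbT.
  by rewrite other_endK qA.
- by rewrite (perm_size pB) size_map sA oddM.
congr (_ + _); rewrite (perm_big _ pAB) /= big_seq_cond.
rewrite (eq_bigl (fun p => (p \in A ++ A')
                  && (is_initial p && ~~ (odd (size u) (+) r)))); last first.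
  move=> p; case pAA: (p \in _) => //=; move: pAA; rewrite mem_cat.
  by case/orP=> [/tauA|/tauB] ->.
rewrite -big_seq_cond; case: (_ (+) _).
  by rewrite big1 // => p; rewrite andbF.
(* The summands of [A] and [A'] are paired by chord: exactly one of the two ends is initial, so each
   chord counts once. *)
rewrite big_cat /= /A' !big_map /= big_mkcond [X in _ + X]big_mkcond -big_split /=.
rewrite (eq_bigr (fun=> sign e)); last first.
  by move=> j _; case: (i (+) _); rewrite ?addr0 ?add0r.
by rewrite big_const_seq count_predT size_iota iter_addr addr0.
Qed.

(** * Comparison with the index *)

Lemma odd_abszDsign b (n : int) : odd `|sign b + n| = ~~ odd `|n|.
Proof. by case: b; case: n => [[|n]|[|n]] //=; rewrite ?negbK // subn1. Qed.

(** The index is a sum of signs, so modulo 2 it is the number of endpoints on the arc, whose parity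
    is read off the positions of the two ends. *)
Lemma odd_ind w p :
  is_gauss_word w -> p \in w -> odd `|ind w p| = ~~ even_chord w p.
Proof.
move=> gw pw; have ew := gauss_even gw; have uw := gauss_uniq gw.
have ows : other_end p \in w by rewrite gauss_otherE.
have ipw : (index p w < size w)%N by rewrite index_mem.
have -> (s : seq endpoint) : odd `|\sum_(q <- s) endpoint_sign q| = odd (size s).
  elim: s => [|q s ih]; first by rewrite big_nil.
  rewrite big_cons /= -ih /endpoint_sign -(odd_abszDsign (is_positive q)).
  case: ifP => _ //; rewrite (_ : - sign _ = sign (~~ is_positive q)).
    by rewrite !odd_abszDsign.
  by case: is_positive.
rewrite /arc size_behead size_takel; last by rewrite ltnW // index_mem mem_rot.
(* The rotated word begins with [p], so the partner comes later; hence the truncated subtraction of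
   1 due to [behead] really flips the parity. *)
have i0 : (0 < index (other_end p) (rot (index p w) w))%N.
  rewrite lt0n; apply/eqP => i0.
  have := nth_index p (_ : other_end p \in rot (index p w) w).
  rewrite i0 mem_rot => /(_ ows)/eqP.
  by rewrite /rot (drop_nth p ipw) /= nth_index // eq_sym other_end_neq.
rewrite -subn1 oddB // odd_index_rot ?(ltnW ipw) //= addbT.
by rewrite /even_chord.
Qed.

Lemma odd_writheE K : odd_writhe K = parity_writhe (diagram_of K).
Proof.
rewrite /odd_writhe /knot_writhe; case: (diagram_of K) => w gw /=.
have odd2 (n : int) : odd `|(2 * n - 1)%R|.
  by rewrite addrC (odd_abszDsign false) abszM oddM.
have divE (n : int) : ((2 * n - 1 + 1) %/ 2)%Z = n by rewrite subrK mulrC mulzK.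
(* [r] contains every [n] such that [2 * n - 1] is the index of a chord, so it covers the support.
   Extra values from even indices or terminal endpoints are harmless. *)
pose r := undup [seq ((ind w p + 1) %/ 2)%Z | p <- w].
have rP p : p \in w -> ((ind w p + 1) %/ 2)%Z \in r.
  by move=> pw; rewrite mem_undup (map_f (fun q => ((ind w q + 1) %/ 2)%Z)).
rewrite (fsbigE r) ?undup_uniq //; last first.
  move=> n _ nr; rewrite /diagram_writhe big1_seq // => p /andP[/andP[_ /eqP e] pw].
  by have := rP p pw; rewrite e divE (negbTE nr).
rewrite (eq_bigl xpredT) => [|n]; last by rewrite in_setT.
under eq_bigr do rewrite /diagram_writhe big_mkcond /=.
(* After the exchange, a chord of odd index is met at exactly one [n], and a chord of even index at
   none. *)
rewrite exchange_big /= /parity_writhe [RHS]big_mkcond /=.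
apply: eq_big_seq => p pw; case: (is_initial p) => /=; last by rewrite big1.
rewrite -odd_ind //; case: ifP => [op|/negbT ep].
  rewrite (bigD1_seq _ (rP p pw)) ?undup_uniq //= big1 ?addr0.
    case: eqP => // ne; case: ne; rewrite mulrC divzK ?addrK //.
    by rewrite dvdzE dvdn2 addrC (odd_abszDsign true) op.
  by move=> n /eqP nn; case: eqP => // e; case: nn; rewrite e divE.
rewrite big1 // => n _; case: eqP => // e.
by move: ep; rewrite e odd2.
Qed.

End ParityWrithe.

(** * Virtual knots presented by words, and invariance of the odd writhe *)

Section Knots.

Local Open Scope ring_scope.

Implicit Types (w u v s t : seq endpoint) (p q : endpoint).

Lemma knot_of_eq (G G' : gauss_diagram) :
  knot_of G = knot_of G' <->
  clos_refl_sym_trans gauss_diagram reidemeister_step G G'.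
Proof.
split=> [/eqquotP/asboolP //|h]; apply/eqquotP; exact/asboolP.
Qed.

Lemma knot_of_diagram_of K : knot_of (diagram_of K) = K.
Proof. exact: reprK. Qed.

Lemma parity_writhe_iso w w' :
  is_gauss_word w -> gauss_iso w w' -> parity_writhe w = parity_writhe w'.
Proof.
move=> gw e; case: e gw => n f {}w fi gw.
rewrite parity_writhe_rename ?parity_writhe_rot //.
  by rewrite (gauss_perm (_ : perm_eq _ w)) // perm_rot.
by move=> x y; rewrite map_rot !mem_rot; apply: fi.
Qed.

Lemma parity_writhe_equiv (G G' : gauss_diagram) :
  clos_refl_sym_trans gauss_diagram reidemeister_step G G' ->
  parity_writhe G = parity_writhe G'.
Proof.
elim=> // [{}G {}G'|? ? ? _ -> _ -> //].
case: G G' => [w gw] [w' gw'] [] /=.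
- exact: parity_writhe_iso.
- exact: parity_writhe_move1.
- exact: parity_writhe_move2.
- exact: parity_writhe_move3.
Qed.

Lemma odd_writhe_knot_of (G : gauss_diagram) :
  odd_writhe (knot_of G) = parity_writhe G.
Proof.
rewrite odd_writheE; apply: parity_writhe_equiv.
exact/knot_of_eq/knot_of_diagram_of.
Qed.

(* Words that are not Gauss words stand for the trivial knot. *)
Definition knot_of_word w : virtual_knot :=
  knot_of (insubd (GaussDiagram (erefl : is_gauss_word [::])) w).

Lemma knot_of_wordE w (gw : is_gauss_word w) :
  knot_of_word w = knot_of (GaussDiagram gw).
Proof.
by rewrite /knot_of_word; congr knot_of; apply: val_inj; rewrite val_insubd gw.
Qed.

Lemma knot_of_gauss (G : gauss_diagram) : knot_of_word G = knot_of G.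
Proof. by case: G => w gw; rewrite knot_of_wordE. Qed.

Lemma odd_writhe_word w :
  is_gauss_word w -> odd_writhe (knot_of_word w) = parity_writhe w.
Proof. by move=> gw; rewrite knot_of_wordE odd_writhe_knot_of. Qed.

Lemma knot_of_word_step w w' :
  is_gauss_word w -> is_gauss_word w' ->
  [\/ gauss_iso w w', move1 w w', move2 w w' | move3 w w'] ->
  knot_of_word w = knot_of_word w'.
Proof.
by move=> gw gw' h; rewrite !knot_of_wordE; apply/knot_of_eq/rst_step.
Qed.

Lemma knot_of_word_rot n w :
  is_gauss_word w -> knot_of_word (rot n w) = knot_of_word w.
Proof.
move=> gw; apply/esym/knot_of_word_step => //.
  by rewrite (@gauss_perm _ w) // perm_rot.
have -> : rot n w = [seq rename id p | p <- rot n w].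
  by rewrite -[LHS]map_id; apply: eq_map => -[[]].
by constructor 1; constructor=> ? ?.
Qed.

Lemma related_by_word move w w' :
  is_gauss_word w -> is_gauss_word w' -> move w w' ->
  related_by move (knot_of_word w) (knot_of_word w').
Proof.
move=> gw gw' h; rewrite !knot_of_wordE.
by exists (GaussDiagram gw), (GaussDiagram gw'); split=> //; left.
Qed.

Lemma related_by_sym move K K' : related_by move K K' -> related_by move K' K.
Proof. by move=> [G [G' [eG eG' /or_comm h]]]; exists G', G. Qed.

Lemma related_by_xi_odd_writhe K K' :
  related_by xi_move K K' -> odd_writhe K = odd_writhe K'.
Proof.
move=> [[w gw] [[w' gw'] [<- <- h]]]; rewrite !odd_writhe_knot_of /=.
by case: h => /parity_writhe_xi -> //.
Qed.

Lemma related_by_twist_odd_writhe k K K' :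
  related_by (twist_move k) K K' ->
  (odd_writhe K = odd_writhe K' %[mod Posz (2 * k)])%Z.
Proof.
have main w w' : is_gauss_word w' -> twist_move k w w' ->
    (parity_writhe w' = parity_writhe w %[mod Posz (2 * k)])%Z.
  move=> gw' [g [e [i [r [u [v [-> ew]]]]]]]; rewrite ew in gw' *.
  rewrite (parity_writhe_twist gw'); case: ifP => _; first by rewrite addr0.
  by rewrite -mulr_natr natz addrC modzMDl.
move=> [[w gw] [[w' gw'] [<- <- h]]]; rewrite !odd_writhe_knot_of /=.
by case: h => /main -> //.
Qed.

Definition xi_related : virtual_knot -> virtual_knot -> Prop :=
  clos_refl_trans virtual_knot (related_by xi_move).

Lemma clos_refl_trans_sym (T : Type) (r : T -> T -> Prop) x y :
  (forall x y, r x y -> r y x) ->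
  clos_refl_trans T r x y -> clos_refl_trans T r y x.
Proof.
move=> rC; elim=> [? ? /rC|?|? ? ? _ h1 _ h2]; [exact: rt_step|exact: rt_refl|].
exact: rt_trans h2 h1.
Qed.

Lemma xi_related_sym K K' : xi_related K K' -> xi_related K' K.
Proof. by apply: clos_refl_trans_sym => ? ?; exact: related_by_sym. Qed.

Lemma xi_related_odd_writhe K K' :
  xi_related K K' -> odd_writhe K = odd_writhe K'.
Proof.
by elim=> [? ?|//|? ? ? _ -> _ -> //]; exact: related_by_xi_odd_writhe.
Qed.

(** [xi_move] acts at the base point; rotating by [size u] brings the triple there without changing
    the knot. *)
Lemma xi_related_word u v p1 p2 p3 (w := u ++ [:: p1, p2, p3 & v])
    (w' := u ++ [:: p3, p2, p1 & v]) :
  is_gauss_word w -> xi_related (knot_of_word w) (knot_of_word w').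
Proof.
move=> gw; have gw' : is_gauss_word w'.
  rewrite -(@gauss_perm w) //; apply/permP=> a; rewrite !count_cat /=.
  by do 3!case: (a _).
rewrite -(knot_of_word_rot (size u) gw) -(knot_of_word_rot (size u) gw').
apply: rt_step; rewrite !rot_size_cat; apply: related_by_word.
- by rewrite (@gauss_perm _ w) // perm_catC.
- by rewrite (@gauss_perm _ w') // perm_catC.
- by exists p1, p2, p3, (v ++ u).
Qed.

(** * Even and odd positions as two independently permutable sequences *)

Fixpoint interleave s t : seq endpoint :=
  match s, t with
  | p :: s', q :: t' => [:: p, q & interleave s' t']
  | _, _ => [::]
  end.

Lemma interleave_cat s1 s2 t1 t2 :
  size s1 = size t1 ->
  interleave (s1 ++ s2) (t1 ++ t2) = interleave s1 t1 ++ interleave s2 t2.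
Proof. by elim: s1 t1 => [[]|p s1 ih [|q t1] //= [/ih ->]]. Qed.

Lemma perm_interleave s t :
  size s = size t -> perm_eq (interleave s t) (s ++ t).
Proof.
elim: s t => [[]|p s ih [|q t] //= [/ih h]] //.
by rewrite perm_cons perm_sym -cat1s perm_catCA /= perm_cons perm_sym.
Qed.

Lemma interleave_surj w :
  ~~ odd (size w) -> exists s t, size s = size t /\ w = interleave s t.
Proof.
have [n] := ubnP (size w); elim: n w => // n ih [|p [|q w]] //=.
  by exists [::], [::].
rewrite negbK => /ltnW/ih h /h [s [t [est ->]]].
by exists (p :: s), (q :: t); rewrite /= est.
Qed.

(** Adjacent transpositions generate all permutations: the head of [s] is located in [t] and carried
    to its place one neighbour at a time. *)
Lemma perm_eq_adjacent (T : eqType) (P : seq T -> seq T -> Prop) :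
  (forall s : seq T, P s s) ->
  (forall s2 s1 s3 : seq T, P s1 s2 -> P s2 s3 -> P s1 s3) ->
  (forall (s t : seq T) x y, P (s ++ [:: x, y & t]) (s ++ [:: y, x & t])) ->
  forall s t : seq T, perm_eq s t -> P s t.
Proof.
move=> Pxx Ptr Psw s t; rewrite -[s]cat0s -[t]cat0s perm_cat2l.
(* The empty prefix is generalized to [c], where letters already in place accumulate. *)
elim: s t [::] => [|x s ih] t c; first by rewrite perm_sym => /perm_nilP ->.
move=> pst; have xt : x \in t by rewrite -(perm_mem pst) mem_head.
move: xt pst => /splitPr[t1 t2].
rewrite perm_sym -cat1s perm_catCA /= perm_cons perm_sym => /ih h.
apply: (Ptr (c ++ x :: t1 ++ t2)); first by rewrite -!cat_rcons.
elim: t1 c {h} => //= y t1 iht c.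
apply: Ptr (Psw _ _ _ _) _; rewrite -!(cat_rcons y); exact: iht.
Qed.

Lemma gauss_interleave s t :
  size s = size t -> is_gauss_word (interleave s t) = is_gauss_word (s ++ t).
Proof. by move=> e; apply/gauss_perm/perm_interleave. Qed.

Lemma split_size2 s1 s2 t p q :
  size (s1 ++ [:: p, q & s2]) = size t ->
  exists t1 p' q' t2, t = t1 ++ [:: p', q' & t2] /\ size s1 = size t1.
Proof.
rewrite size_cat /= !addnS => e; exists (take (size s1) t).
have le : (size s1 <= size t)%N by rewrite -e ltnW // ltnW // !ltnS leq_addr.
have : size (drop (size s1) t) = (size s2).+2.
  by rewrite size_drop -e -!addnS addKn.
case E: (drop _ _) => [|x' [|y' v]] // _.
by exists x', y', v; rewrite -E cat_take_drop size_takel.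
Qed.

Lemma xi_related_interleavel s s' t :
  perm_eq s s' -> size s = size t -> is_gauss_word (interleave s t) ->
  xi_related (knot_of_word (interleave s t)) (knot_of_word (interleave s' t)).
Proof.
(* [P] carries the permutation along because transitivity needs the size and well-formedness of the
   middle word. *)
move=> ps; pose P s1 s2 := perm_eq s1 s2 /\
  forall t, size s1 = size t -> is_gauss_word (interleave s1 t) ->
  xi_related (knot_of_word (interleave s1 t)) (knot_of_word (interleave s2 t)).
suff: P s s' by case=> _; apply.
apply: perm_eq_adjacent ps => [s1|s2 s1 s3 [p12 h12] [p23 h23]|s1 s2 x y].
- by split=> // *; apply: rt_refl.
- split=> [|{}t e g]; first exact: perm_trans p12 p23.
  apply: rt_trans (h12 _ e g) (h23 _ _ _); first by rewrite -(perm_size p12).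
  rewrite gauss_interleave -?(perm_size p12) //.
  by rewrite -(@gauss_perm (s1 ++ t)) -?gauss_interleave // perm_cat2r.
- split=> [|{}t e]; first by apply/permP=> a; rewrite !count_cat /= (addnCA (a x)).
  (* Only [x'] lies between [x] and [y] in the interleaved word, so their swap is a single
     Xi-move. *)
  have [t1 [x' [y' [t2 [-> e1]]]]] := split_size2 e.
  rewrite !interleave_cat //=; exact: xi_related_word.
Qed.

Lemma xi_related_interleaver s t t' :
  perm_eq t t' -> size s = size t -> is_gauss_word (interleave s t) ->
  xi_related (knot_of_word (interleave s t)) (knot_of_word (interleave s t')).
Proof.
move=> pt; pose P t1 t2 := perm_eq t1 t2 /\
  forall s, size s = size t1 -> is_gauss_word (interleave s t1) ->
  xi_related (knot_of_word (interleave s t1)) (knot_of_word (interleave s t2)).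
suff: P t t' by case=> _; apply.
apply: perm_eq_adjacent pt => [t1|t2 t1 t3 [p12 h12] [p23 h23]|t1 t2 x y].
- by split=> // *; apply: rt_refl.
- split=> [|{}s e g]; first exact: perm_trans p12 p23.
  apply: rt_trans (h12 _ e g) (h23 _ _ _); first by rewrite -(perm_size p12).
  rewrite gauss_interleave -?(perm_size p12) //.
  by rewrite -(@gauss_perm (s ++ t1)) -?gauss_interleave // perm_cat2l.
- split=> [|{}s /esym e]; first by apply/permP=> a; rewrite !count_cat /= (addnCA (a x)).
  have [s1 [x' [y' [s2 [-> e1]]]]] := split_size2 e.
  (* Here the triple is [x], [y'], [y]; the letter [x'] before it is absorbed into the prefix. *)
  have := @xi_related_word (rcons (interleave s1 t1) x') (interleave s2 t2) x y' y.
  by rewrite !cat_rcons !interleave_cat.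
Qed.

Lemma xi_related_interleave s s' t t' :
  perm_eq s s' -> perm_eq t t' -> size s = size t ->
  is_gauss_word (interleave s t) ->
  xi_related (knot_of_word (interleave s t)) (knot_of_word (interleave s' t')).
Proof.
move=> ps pt e g.
apply: rt_trans (xi_related_interleavel ps e g) (xi_related_interleaver pt _ _).
  by rewrite -(perm_size ps).
rewrite gauss_interleave -?(perm_size ps) //.
by rewrite -(@gauss_perm (s ++ t)) -?gauss_interleave // perm_cat2r.
Qed.

(** * Normal forms under Xi-moves *)

Definition chord_pairs (e : bool) (c : seq nat) : seq endpoint :=
  flatten [seq [:: (x, true, e); (x, false, e)] | x <- c].

Lemma size_chord_pairs e c : size (chord_pairs e c) = (2 * size c)%N.
Proof. by elim: c => //= x c ih; rewrite mulnS -ih. Qed.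

Lemma mem_chord_pairs e c p :
  (p \in chord_pairs e c) = (is_positive p == e) && (chord_name p \in c).
Proof.
case: p => [[n i] d]; elim: c => [|x c ih]; first by rewrite andbF.
rewrite /chord_pairs /= !in_cons -/(chord_pairs e c) ih /is_positive /chord_name /=.
rewrite !xpair_eqE; case: (n == x); case: (d == e); case: i {ih} => //=.
Qed.

Lemma gauss_chord_pairs e c : is_gauss_word (chord_pairs e c) = uniq c.
Proof.
have cl : all (fun p => other_end p \in chord_pairs e c) (chord_pairs e c).
  by apply/allP=> p; rewrite !mem_chord_pairs.
rewrite /is_gauss_word cl andbT; elim: c {cl} => //= x c ->.
rewrite inE negb_or /= -andbA; set b := (_, _) \in _; set b' := (_, _) \in _.
have mem i : ((x, i) \in [seq (chord_name p, is_initial p) | p <- chord_pairs e c])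
    = (x \in c).
  apply/mapP/idP => [[[[n j] d]]|xc].
    by rewrite mem_chord_pairs => /andP[_ nc] [-> _].
  by exists (x, i, e); rewrite // mem_chord_pairs eqxx.
by rewrite /b /b' !mem xpair_eqE andbF /= andbA andbb.
Qed.

Lemma perm_chord_pairs e s :
  {in s, forall p, is_positive p = e} ->
  perm_eq (s ++ map other_end s) (chord_pairs e (map chord_name s)).
Proof.
elim: s => // -[[n i] d] s ih es.
have -> : d = e by have := es _ (mem_head _ _).
apply/permP=> a; rewrite /= count_cat /= (addnCA (count a s)) -count_cat.
rewrite (permP (ih _)) => [|p ps]; last by rewrite es // inE ps orbT.
by rewrite !addnA; congr (_ + _)%N; case: i {es}; rewrite // addnC.
Qed.

Lemma gauss_perm_chord_pairs e s :
  is_gauss_word s -> {in s, forall p, is_positive p = e} ->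
  exists c, perm_eq s (chord_pairs e c).
Proof.
move=> gs es; set I := [seq p <- s | is_initial p].
exists (map chord_name I); rewrite (permPl (perm_initial gs)).
by apply: perm_chord_pairs => p; rewrite mem_filter => /andP[_ /es].
Qed.

(** The normal form: [m] blocks x y x y, with x on even and y on odd positions, under disjoint sets
    of names. *)
Definition standard_word e m : seq endpoint :=
  interleave (chord_pairs e (iota 0 m)) (chord_pairs e (iota m m)).

Lemma gauss_interleave_pairs e c d :
  size c = size d ->
  is_gauss_word (interleave (chord_pairs e c) (chord_pairs e d)) = uniq (c ++ d).
Proof.
move=> scd; rewrite gauss_interleave ?size_chord_pairs ?scd //.
by rewrite -(gauss_chord_pairs e) /chord_pairs map_cat flatten_cat.
Qed.

Lemma gauss_standard e m : is_gauss_word (standard_word e m).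
Proof. by rewrite gauss_interleave_pairs ?size_iota // -iotaD iota_uniq. Qed.

Lemma parity_writhe_interleave_pairs e c d :
  size c = size d -> uniq (c ++ d) ->
  parity_writhe (interleave (chord_pairs e c) (chord_pairs e d))
  = sign e *+ (2 * size c).
Proof.
elim: c d => [|x c ih] [|y d] //; first by rewrite /parity_writhe big_nil.
case=> scd ucd; have := ucd; rewrite /= cat_uniq mem_cat inE !negb_or.
case/andP=> /and3P[_ /negbTE nxy _] /and3P[uc /andP[_ hcd] /andP[_ ud]].
have gw : is_gauss_word
    (interleave (chord_pairs e (x :: c)) (chord_pairs e (y :: d))).
  by rewrite gauss_interleave_pairs //= scd.
(* The leading block x y x y is split off; its two chords have ends two places apart and contribute
   [sign e] each. *)
have := @parity_writhe_insert [:: (x, true, e); (y, true, e); (x, false, e);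
  (y, false, e)] [::] [::] _ gw isT isT => /= ->; last first.
  by rewrite /other_end /= !inE !eqxx !orbT.
rewrite ih //; last by rewrite cat_uniq uc hcd.
rewrite !big_cons big_nil /even_chord /= /other_end /= !xpair_eqE !eqxx /=.
by rewrite nxy eq_sym nxy /= addr0 addrC mulnS (mulrnDr _ 2) mulr2n.
Qed.

Lemma parity_writhe_standard e m :
  parity_writhe (standard_word e m) = sign e *+ (2 * m).
Proof.
by rewrite parity_writhe_interleave_pairs ?size_iota // -iotaD iota_uniq.
Qed.

Lemma map_interleave f s t :
  map f (interleave s t) = interleave (map f s) (map f t).
Proof. by elim: s t => [[]|p s ih [|q t]] //=; rewrite ih. Qed.

Lemma map_rename_pairs f e c :
  map (rename f) (chord_pairs e c) = chord_pairs e (map f c).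
Proof. by elim: c => //= x c ih; rewrite -[in LHS]/(chord_pairs _ _) ih. Qed.

Lemma map_index_iota (T : eqType) (s : seq T) :
  uniq s -> [seq index x s | x <- s] = iota 0 (size s).
Proof.
move=> us; case: s us => // x0 s us.
apply: (@eq_from_nth _ 0%N); rewrite size_map ?size_iota // => i lt.
by rewrite (nth_map x0) // nth_iota // index_uniq.
Qed.

Lemma knot_of_interleave_pairs e c d :
  size c = size d -> uniq (c ++ d) ->
  knot_of_word (interleave (chord_pairs e c) (chord_pairs e d))
  = knot_of_word (standard_word e (size c)).
Proof.
move=> scd ucd; apply: knot_of_word_step.
- by rewrite gauss_interleave_pairs.
- exact: gauss_standard.
(* Renaming by position in [c ++ d] sends [c] and [d] to the consecutive intervals of
   [standard_word], injectively on the names that occur. *)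
pose f x := index x (c ++ d).
have [fc fd] : map f c = iota 0 (size c) /\ map f d = iota (size c) (size c).
  have := map_index_iota ucd; rewrite map_cat size_cat -scd iotaD.
  by move/eqP; rewrite eqseq_cat ?size_map ?size_iota // => /andP[/eqP-> /eqP->].
rewrite /standard_word -fc -fd -!map_rename_pairs -map_interleave.
rewrite -{2}[interleave _ _]rot0; constructor 1; constructor.
have sub x :
    x \in map chord_name (interleave (chord_pairs e c) (chord_pairs e d)) ->
    x \in c ++ d.
  case/mapP=> p; rewrite (perm_mem (perm_interleave _)) ?size_chord_pairs ?scd //.
  by move=> + ->; rewrite !mem_cat !mem_chord_pairs => /orP[] /andP[_ ->];
    rewrite ?orbT.
by move=> y z /sub ycd /sub zcd; apply: (index_inj 0%N).
Qed.

(** Each position class can be sorted into pairs of ends of one chord; the classes have equal size,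
    so they hold equally many chords. *)
Lemma xi_related_one_sign e s t :
  size s = size t -> is_gauss_word (s ++ t) -> is_gauss_word s -> is_gauss_word t ->
  {in s ++ t, forall p, is_positive p = e} ->
  exists m, xi_related (knot_of_word (interleave s t))
                       (knot_of_word (standard_word e m)).
Proof.
move=> est gst gs gt pst.
have [c pc] : exists c, perm_eq s (chord_pairs e c).
  by apply: gauss_perm_chord_pairs => // p ps; rewrite pst // mem_cat ps.
have [d pd] : exists d, perm_eq t (chord_pairs e d).
  by apply: gauss_perm_chord_pairs => // p pt; rewrite pst // mem_cat pt orbT.
have scd : size c = size d.
  have := est; rewrite (perm_size pc) (perm_size pd) !size_chord_pairs !mul2n.
  exact: double_inj.
exists (size c); rewrite -(knot_of_interleave_pairs e scd).
  by apply: xi_related_interleave => //; rewrite gauss_interleave.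
rewrite -(gauss_interleave_pairs e scd) gauss_interleave ?size_chord_pairs ?scd //.
by rewrite -(@gauss_perm (s ++ t)) // perm_cat.
Qed.

Lemma xi_related_standard w :
  is_gauss_word w ->
  exists e m, xi_related (knot_of_word w) (knot_of_word (standard_word e m)).
Proof.
have [n] := ubnP (size w); elim: n w => // n ih w /ltnSE le_wn gw.
have [s [t [est ew]]] := interleave_surj (gauss_even gw); subst w.
have gst : is_gauss_word (s ++ t) by rewrite -gauss_interleave.
have ust := gauss_uniq gst.
(* Common core of both reductions: Xi-moves bring [s1] and [t1] to the front of their classes, move
   I or II deletes the leading block, and induction handles the shorter rest. *)
have reduce s1 s2 t1 t2 :
    perm_eq s (s1 ++ s2) -> perm_eq t (t1 ++ t2) -> size s1 = size t1 ->
    (0 < size s1)%N ->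
    all (fun p => other_end p \in interleave s1 t1) (interleave s1 t1) ->
    (forall v, move1 (interleave s1 t1 ++ v) v \/ move2 (interleave s1 t1 ++ v) v) ->
    exists e m, xi_related (knot_of_word (interleave s t))
                           (knot_of_word (standard_word e m)).
  move=> ps pt e1 s1_gt0 cl mv.
  have e2 : size s2 = size t2.
    have := est; rewrite (perm_size ps) (perm_size pt) !size_cat e1.
    exact: addnI.
  have g12 : is_gauss_word (interleave s1 t1 ++ interleave s2 t2).
    rewrite -interleave_cat // gauss_interleave ?size_cat ?e1 ?e2 //.
    by rewrite -(@gauss_perm (s ++ t)) // perm_cat.
  have g2 := gauss_catr cl g12.
  have [|e [m h]] := ih (interleave s2 t2) _ g2.
    apply: leq_trans le_wn; rewrite !(perm_size (perm_interleave _)) //.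
    rewrite !size_cat (perm_size ps) (perm_size pt) !size_cat.
    by rewrite -addnACA -[X in (X < _)%N]add0n ltn_add2r ltn_addr.
  exists e, m; apply: rt_trans h.
  rewrite -(knot_of_word_step g12 g2); last first.
    by case: (mv (interleave s2 t2)) => h; [constructor 2|constructor 3].
  by rewrite -interleave_cat //; apply: xi_related_interleave.
have [/hasP[p ps opt]|/hasPn even_free] := boolP (has (fun p => other_end p \in t) s).
  apply: (reduce [:: p] (rem p s) [:: other_end p] (rem (other_end p) t)) => //.
  - exact: perm_to_rem.
  - exact: perm_to_rem.
  - by rewrite /= !inE other_endK !eqxx orbT.
  by move=> v; left; case: p {ps opt} => [[x i] e]; exists x, i, e.
(* From here on no chord joins the two classes, so each class is a Gauss word by itself. *)
have cs p : p \in s -> other_end p \in s.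
  move=> ps; have : other_end p \in s ++ t by rewrite gauss_otherE // mem_cat ps.
  by rewrite mem_cat (negbTE (even_free _ ps)) orbF.
have ct p : p \in t -> other_end p \in t.
  move=> pt; have : other_end p \in s ++ t by rewrite gauss_otherE // mem_cat pt orbT.
  rewrite mem_cat => /orP[/even_free|//]; by rewrite other_endK pt.
have gt : is_gauss_word t by apply: gauss_catr gst; apply/allP.
have gs : is_gauss_word s.
  apply: (@gauss_catr t); first exact/allP.
  by rewrite (@gauss_perm _ (s ++ t)) // perm_catC.
have front r x i e : is_gauss_word r -> (x, i, e) \in r ->
    exists r', perm_eq r ([:: (x, true, e); (x, false, e)] ++ r').
  move=> gr xr.
  have [xt xf] : (x, true, e) \in r /\ (x, false, e) \in r.
    have := gauss_other gr xr; rewrite /other_end /is_initial /=.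
    by case: i xr; split.
  exists (rem (x, false, e) (rem (x, true, e) r)).
  rewrite (permPl (perm_to_rem xt)) perm_cons perm_to_rem //.
  by rewrite (mem_rem_uniq _ (gauss_uniq gr)) inE xf !xpair_eqE /= andbF.
(* For chords of opposite signs in different classes, the layout x y x y with initial ends first is
   move II with empty [u] and its order flag [false]. *)
have [/hasP[[[x i] e] xs /hasP[[[y j] d] yt /= ne]]|/hasPn same] :=
  boolP (has (fun p => has (fun q => is_positive p != is_positive q) t) s).
  have {ne} de : d = ~~ e by move: ne; rewrite /is_positive /=; case: (d); case: (e).
  subst d.
  have [s' ps] := front _ _ _ _ gs xs; have [t' pt] := front _ _ _ _ gt yt.
  apply: (reduce _ _ _ _ ps pt) => //.
    by rewrite /= /other_end /= !inE !eqxx !orbT.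
  by move=> v; right; exists x, y, e, false, [::], v.
have one p q : p \in s -> q \in t -> is_positive p = is_positive q.
  by move=> ps qt; have /hasPn/(_ q qt) := same p ps; rewrite negbK => /eqP.
have [e pst] : exists e, {in s ++ t, forall p, is_positive p = e}.
  (* Having equal size, the classes are both empty, where any sign will do, or both inhabited, where
     comparison across them yields one common sign. *)
  case: (s) (t) est one => [|p s'] [|q t'] // _ one; first by exists true.
  exists (is_positive p) => r; rewrite mem_cat => /orP[rs|rt].
    by rewrite !(one _ q) ?mem_head.
  by rewrite (one p r) ?mem_head.
by exists e; apply: xi_related_one_sign.
Qed.

(** * Classification by the odd writhe, and shifts by multiples of [2 * k] *)

Lemma knot_of_standard_inj e m e' m' :
  sign e *+ (2 * m) = sign e' *+ (2 * m') ->
  knot_of_word (standard_word e m) = knot_of_word (standard_word e' m').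
Proof.
have inj (a b : nat) : (2 * a)%:R = (2 * b)%:R :> int -> a = b.
  by move/eqP; rewrite eqr_nat eqn_mul2l /= => /eqP.
(* With opposite signs, equality is possible only at zero, where both standard words are empty. *)
have inj0 (a b : nat) : - (2 * a)%:R = (2 * b)%:R :> int -> a = 0%N /\ b = 0%N.
  move/eqP; rewrite eqr_oppLR -subr_eq0 opprK -natrD pnatr_eq0 addn_eq0 !muln_eq0.
  by case/andP=> /eqP-> /eqP->.
case: e; case: e'; rewrite /sign ?mulNrn.
- by move/inj ->.
- by move/esym/inj0 => [-> ->].
- by move/inj0 => [-> ->].
- by move/oppr_inj/inj ->.
Qed.

Lemma xi_related_eq_odd_writhe K K' :
  odd_writhe K = odd_writhe K' -> xi_related K K'.
Proof.
rewrite -(knot_of_diagram_of K) -(knot_of_diagram_of K') -!knot_of_gauss.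
case: (diagram_of K) (diagram_of K') => [w gw] [w' gw'] /= eJ.
have [e [m h]] := xi_related_standard gw.
have [e' [m' h']] := xi_related_standard gw'.
have eq_std : sign e *+ (2 * m) = sign e' *+ (2 * m').
  rewrite -!parity_writhe_standard -!odd_writhe_word ?gauss_standard //.
  by rewrite -(xi_related_odd_writhe h) -(xi_related_odd_writhe h').
rewrite (knot_of_standard_inj eq_std) in h.
exact: rt_trans h (xi_related_sym h').
Qed.

(** A twist on adjacent arcs with the same order on both makes every new chord odd: this is
    [parity_writhe_twist] with empty [u] and [r] false. The sign [e] gives the direction of the
    shift. *)
Lemma related_by_twist_add k e K :
  exists2 K', related_by (twist_move k) K K'
            & odd_writhe K' = odd_writhe K + sign e *+ (2 * k).
Proof.
rewrite -(knot_of_diagram_of K) -knot_of_gauss.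
case: (diagram_of K) => w gw /=.
(* Names above the maximum of those in [w] are fresh. *)
pose g j := ((\max_(p <- w) chord_name p).+1 + j)%N.
pose A := [seq (g j, true (+) odd j, e) | j <- iota 0 (2 * k)].
have pA : perm_eq (A ++ map other_end A) (chord_pairs e (map chord_name A)).
  by apply: perm_chord_pairs => _ /mapP[j _ ->].
have gA : is_gauss_word (A ++ map other_end A).
  rewrite (gauss_perm pA) gauss_chord_pairs -map_comp map_inj_uniq ?iota_uniq //.
  by move=> i j /addnI.
have gw' : is_gauss_word (A ++ [::] ++ map other_end A ++ w).
  rewrite /= catA; apply: gauss_cat => // p q.
  rewrite (perm_mem pA) mem_chord_pairs => /andP[_].
  rewrite -map_comp => /mapP[j _ ->] qw; rewrite gtn_eqF //= /g addSn ltnS.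
  by apply: leq_trans (leq_addr _ _); apply: leq_bigmax_seq.
exists (knot_of_word (A ++ [::] ++ map other_end A ++ w)).
  by apply: related_by_word => //; exists g, e, true, false, [::], w.
by rewrite !odd_writhe_word // (parity_writhe_twist (r := false) gw').
Qed.

End Knots.

Theorem theorem1p3 (k : nat) (hk : (0 < k)%N) (K K' : virtual_knot) :
  (odd_writhe K = odd_writhe K' %[mod Posz (2 * k)])%Z
  <->
  clos_refl_trans virtual_knot
    (fun L L' => related_by (twist_move k) L L' \/ related_by xi_move L L')
    K K'.
Proof.
split=> [|h]; last first.
  elim: h => [L L' []|//|L1 L2 L3 _ -> _ -> //].
    exact: related_by_twist_odd_writhe.
  by move/related_by_xi_odd_writhe ->.
have twists e n L : exists2 L', clos_refl_trans virtual_knot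
    (fun L L' => related_by (twist_move k) L L' \/ related_by xi_move L L') L L'
    & odd_writhe L' = (odd_writhe L + sign e *+ (2 * k) *+ n)%R.
  elim: n => [|n [L1 h1 e1]].
    by exists L; [exact: rt_refl|rewrite mulr0n addr0].
  have [L2 h2 e2] := related_by_twist_add k e L1.
  exists L2; last by rewrite e2 e1 mulrSr addrA.
  by apply: rt_trans h1 (rt_step _ _ _ _ _); left.
move/eqP; rewrite eq_sym eqz_mod_dvd => /dvdzP[q /eqP]; rewrite subr_eq => /eqP eJ.
(* The writhes of [K'] and [K] differ by [q] times [2 * k]; as many twists as the absolute value of
   [q], with the sign of [q], make up the difference. *)
have [L h eL] := twists (0 <= q)%R `|q|%N K.
apply: rt_trans h _.
suff : xi_related L K'.
  elim=> [x y xy|x|x y z _ h1 _ h2]; [by apply: rt_step; right|exact: rt_refl|].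
  exact: rt_trans h1 h2.
apply: xi_related_eq_odd_writhe; rewrite eL eJ addrC; congr (_ + _)%R.
rewrite -mulrnA -mulr_natr natz PoszM mulrCA mulrC; congr (_ * _)%R.
by case: q {eJ eL} => n; rewrite /sign /= ?mul1r // mulN1r NegzE.
Qed.
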